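(* Let $G$ be a finite abelian group. (1) If $G$ and all its subgroups have the PT property, then every tile of $G$ containing $0$ has the ascending chain structure. (2) If every tile of $G$ containing $0$ has the ascending chain structure, then $G$ has the PT property.
   Context: For a finite abelian group $G$ (written additively), a pair $(\Omega,T)$ of subsets of $G$ is a tiling pair if every $g\in G$ can be written uniquely as $g=\omega+t$ with $\omega\in\Omega$, $t\in T$; then $\Omega$ is called a tile. A nonempty subset $A\subset G$ is periodic if there is a nonzero $g\in G$ with $A+g=A$. $G$ has the PT property if for every tiling pair $(\Omega,T)$ of $G$, either $\Omega$ is periodic, or there is a periodic set $T'\subset G$ such that $(\Omega,T')$ is also a tiling pair. Convention: the trivial group is regarded as having the PT property. For subsets $A,B\subset G$ with $0\in A\cap B$ and a function $\phi:B\to A$ with $\phi(0)=0$, put $A\circ_\phi B=\{\phi(b)+b: b\in B\}$. A set $E\subset G$ has the ascending chain structure if there exist a strictly ascending chain of subgroups $\{0\}=H_0\subsetneq H_1\subsetneq\cdots\subsetneq H_m=G$ and, for $j=1,\dots,m-1$, a complete set $D_j\ni 0$ of coset representatives for $H_{j+1}$ modulo $H_j$, such that $$E=H_1+(D_1\circ_{\phi_1}(D_2+(\cdots\{0\})))\quad\text{or}\quad E=H_1\circ_{\phi_1}(D_1+(D_2\circ_{\phi_2}(\cdots\{0\})))$$ for some functions $\phi_i$. Explicitly: put $D_0=H_1$ and $E_m=\{0\}$, and for $j=m-1,m-2,\dots,0$ let $E_j$ be either $D_j+E_{j+1}$ or $D_j\circ_{\phi}E_{j+1}$ for some function $\phi:E_{j+1}\to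 D_j$ with $\phi(0)=0$, where the two operations strictly alternate with $j$ (i.e. either the sum is used for all even $j$ and $\circ$ for all odd $j$, or the sum is used for all odd $j$ and $\circ$ for all even $j$); then $E=E_0$. (If $G$ is trivial, $m=0$ and $E=\{0\}$.) *)

(* Defs.v *)
From mathcomp Require Import all_boot all_fingroup.

Set Implicit Arguments.
Unset Strict Implicit.
Unset Printing Implicit Defensive.

Import GroupScope.

(* Finite abelian groups are groups [G : {group gT}] with [abelian G], so the
   group law is written multiplicatively: [1] stands for 0, [x * y] for x + y,
   [A * B] for the sumset A + B and [A :* g] for the translate A + g. *)

Definition tiling_pair (gT : finGroupType) (G : {group gT})
    (Omega T : {set gT}) : Prop :=
  [/\ Omega \subset G, T \subset G &
      forall g, g \in G ->
        exists! p : gT * gT, [/\ p.1 \in Omega, p.2 \in T & g = p.1 * p.2]].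

Definition tile (gT : finGroupType) (G : {group gT}) (Omega : {set gT}) : Prop :=
  exists T : {set gT}, tiling_pair G Omega T.

Definition periodic (gT : finGroupType) (G : {group gT}) (A : {set gT}) : Prop :=
  A != set0 /\ exists g, [/\ g \in G, g != 1 & A :* g = A].

(* The first disjunct is the convention that the trivial group has the PT
   property, which the second disjunct alone would not give. *)
Definition PT_property (gT : finGroupType) (G : {group gT}) : Prop :=
  G :=: 1 \/
  forall Omega T : {set gT}, tiling_pair G Omega T ->
    periodic G Omega \/
    exists T' : {set gT}, periodic G T' /\ tiling_pair G Omega T'.

Definition circ (gT : finGroupType) (phi : gT -> gT) (B : {set gT}) : {set gT} :=
  [set phi b * b | b in B].

(* [phi] is total on [gT], but only its values on [B] matter. *)
Definition is_circ (gT : finGroupType) (A B E : {set gT}) : Prop :=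
  exists phi : gT -> gT,
    [/\ forall b, b \in B -> phi b \in A, phi 1 = 1 & E = circ phi B].

Definition coset_reps (gT : finGroupType) (H K : {group gT}) (D : {set gT}) : Prop :=
  is_transversal D (rcosets H K) K.

(* The families are indexed by all of [nat]; only [H j] for [j <= m], [D j]
   for [j < m] and [E j] for [j <= m] are meaningful. The boolean [s] says
   whether the sum is used at odd indices (true) or at even ones (false). *)
Definition ascending_chain_structure (gT : finGroupType) (G : {group gT})
    (A : {set gT}) : Prop :=
  exists (m : nat) (H : nat -> {group gT}) (D E : nat -> {set gT}) (s : bool),
    [/\ [/\ H 0 :=: 1, H m :=: G &
            forall j : nat, j < m -> H j \proper H j.+1],
        D 0 = H 1%N /\
        (forall j : nat, 0 < j < m ->
           1 \in D j /\ coset_reps (H j) (H j.+1) (D j)),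
        E m = [set 1],
        (forall j : nat, j < m ->
           if odd j == s then E j = D j * E j.+1
           else is_circ (D j) (E j.+1) (E j)) &
        A = E 0].

(* Main.v *)
(* Call E a "chain modulo H" when E = E_j for a subgroup H = H_j. For (1), let
   (B, T) be a tiling of G modulo H. By the PT property of G / H, either B is
   invariant under some K > H, or T may be replaced by a K-invariant set; in
   both cases (B, T) is also a tiling modulo K, so by induction B agrees
   modulo K with a chain E modulo K. With D a set of representatives of K / H,
   the set B agrees modulo H with D * E in the first case and with some D
   o_phi E in the second. The PT property passes to G / H because every
   quotient of a finite abelian group G embeds in G: an element x of prime
   order p lies in a cyclic direct factor C, and <x> is the kernel of the
   endomorphism that is the p-th power on C and the identity on a complement.

   For (2), a complement of E modulo H is built along the chain: if S
   complements E modulo K, then S complements D * E modulo H and D * S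
   complements any D o_phi E modulo H. At the bottom of the chain D = K, so
   either the tile K * E or its complement K * S is periodic. *)
Require Import Defs.
From mathcomp Require Import all_boot all_fingroup all_solvable.

Set Implicit Arguments.
Unset Strict Implicit.
Unset Printing Implicit Defensive.

Import GroupScope.

(** * Quotients of finite abelian groups embed in them *)

(** A cyclic [p]-group has at most one subgroup of order [p]; by Cauchy, [<[d]>] contains one, so it
    must be [<[v]>]. *)
Lemma cyclic_p_elt_order_p (gT : finGroupType) (p : nat) (c d v : gT) :
  p.-elt c -> d \in <[c]> -> d != 1 -> v \in <[c]> -> #[v] = p -> prime p ->
  v \in <[d]>.
Proof.
move=> pc dc d1 vc ov pr_p.
have pd : p.-group <[d]> by apply: pgroupS pc; rewrite cycle_subG.
have [|_ p_dv _] := pgroup_pdiv pd; first by rewrite cycle_eq1.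
have [w wd ow] := Cauchy pr_p p_dv.
have: <[v]> == <[w]>.
  rewrite (eq_subG_cyclic (cycle_cyclic c)) ?cycle_subG //.
    by rewrite -!orderE ov ow.
  by move: wd; apply/subsetP; rewrite cycle_subG.
by move/eqP=> evw; rewrite -cycle_subG evw cycle_subG.
Qed.

(** Multiplying the generator of smaller order by a power of [c] gives another complement of
    [<[c]>], and the power can be chosen so that this complement contains the diagonal element
    [u * v]. The bound on orders ensures that [u != 1] forces [c ^+ s != 1], so [v] is a power of
    [c ^+ s]. *)
Lemma cyclic_dprod_shear (gT : finGroupType) (p : nat) (z c u v : gT)
    (Q : {group gT}) :
  prime p -> p.-elt z -> p.-elt c -> <[z]> \x <[c]> = Q ->
  u \in <[z]> -> v \in <[c]> -> #[u] = p -> #[v] = p -> #[z] <= #[c] ->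
  exists2 y, <[y]> \x <[c]> = Q & u * v \in <[y]>.
Proof.
move=> pr_p pz pc dQ uz vc ou ov le_zc.
have [_ defQ cent_zc tiQ] := dprodP dQ.
have czc : commute z c.
  apply/cent1P; rewrite -cent_cycle; apply: (subsetP _) (cycle_id z).
  by rewrite centsC.
have /cycleP[s us] := uz.
have u1 : u != 1 by rewrite -order_eq1 ou neq_ltn prime_gt1 ?orbT.
have [/p_natP [i oz] /p_natP [j oc]] := (pz, pc).
have le_ij : i <= j by rewrite -(leq_exp2l _ _ (prime_gt1 pr_p)) -oz -oc.
have ns : ~~ (p ^ i %| s) by rewrite -oz order_dvdn -us.
have cs1 : c ^+ s != 1.
  rewrite -order_dvdn oc; apply: contra ns; apply: dvdn_trans.
  exact: dvdn_exp2l.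
have := cyclic_p_elt_order_p pc (mem_cycle c s) cs1 vc ov pr_p.
case/cycleP=> t vt.
(* Since [u = z ^+ s] and [v = c ^+ s ^+ t], the [s]-th power of
   [z * c ^+ t] is [u * v]. *)
exists (z * c ^+ t); last first.
  apply/cycleP; exists s; rewrite expgMn; last exact: commuteX.
  by rewrite -us vt -!expgM mulnC.
(* If [c ^+ t] had order [p ^ k] with [k > i], then [v ^+ p = 1] would give [p ^ i.+1 %| s * p],
   hence [p ^ i %| s], contradicting [u != 1]. *)
have ct1 : c ^+ t ^+ #[z] = 1.
  have pct : p.-elt (c ^+ t) by apply: mem_p_elt pc (mem_cycle _ _).
  have [k ok] := p_natP pct.
  apply/eqP; rewrite -order_dvdn ok oz dvdn_exp2l // leqNgt.
  apply: contra ns => ltik.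
  have: p ^ k %| s * p.
    rewrite -ok order_dvdn -expgM mulnA (mulnC t) expgM [c ^+ _]expgM.
    by rewrite -vt -ov expg_order.
  move/(dvdn_trans (dvdn_exp2l p ltik)).
  by rewrite expnSr dvdn_pmul2r ?prime_gt0.
have cy : commute (z * c ^+ t) c.
  by apply: commute_sym; apply: commuteM; [|apply: commuteX].
have cyc : <[c]> \subset 'C(<[z * c ^+ t]>).
  by rewrite cycle_subG /= cent_cycle; apply/cent1P/commute_sym.
rewrite dprodE //.
- rewrite -(cent_joinEr cyc); apply/eqP; rewrite eqEsubset -defQ.
  rewrite -{1}(cent_joinEr cent_zc) !join_subG !joing_subr.
  rewrite cycle_subG groupM ?mem_gen ?inE ?cycle_id ?mem_cycle ?orbT //=.
  rewrite mul_subG ?joing_subr // cycle_subG -{1}(mulgK (c ^+ t) z) /=.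
  by rewrite groupM ?groupV ?mem_gen ?inE ?cycle_id ?mem_cycle ?orbT.
(* A power [n] of the new generator lying in [<[c]>] forces [z ^+ n = 1], so [#[z]] divides [n] and
   [ct1] kills the other factor as well. *)
- apply/trivgP/subsetP=> _ /setIP[/cycleP[n ->]].
  rewrite expgMn; last exact: commuteX.
  rewrite groupMr => [znc|]; last by rewrite !groupX ?cycle_id.
  have: z ^+ n \in <[z]> :&: <[c]> by rewrite inE mem_cycle.
  rewrite tiQ inE => zn1; rewrite (eqP zn1).
  move: zn1; rewrite -order_dvdn => /dvdnP[k ->].
  by rewrite mulnC expgM ct1 expg1n mul1g group1.
Qed.

(** Induction on a decomposition of [G] into cyclic factors: write [x = u * v] with [u] in the first
    factor and, inductively, [v] in a cyclic factor of the rest. If neither component is trivial,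
    shear whichever generator has the smaller order. *)
Lemma cyclic_dprod_factor_pgroup (gT : finGroupType) (p : nat) (x : gT)
    (G : {group gT}) :
  abelian G -> p.-group G -> x \in G -> prime p -> #[x] = p ->
  exists C K : {group gT}, [/\ C \x K = G, cyclic C & x \in C].
Proof.
move=> abG + + pr_p; have [b + _] := abelian_structure abG.
elim: b G {abG} x => [|z b IHb] G x.
  rewrite big_nil => <- _; rewrite inE => /eqP->.
  by rewrite order1 => p1; rewrite -p1 in pr_p.
rewrite big_cons => /[dup] dG /dprodP[[Z L defZ dL] defG cZL tiZL] pG xG ox.
rewrite dL in dG cZL tiZL defG.
have ntord (w : gT) : w ^+ p = 1 -> w != 1 -> #[w] = p.
  by move=> /eqP; rewrite -order_dvdn -order_eq1 => /(prime_nt_dvdP pr_p) e /e.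
have pz : p.-elt z.
  by apply: pgroupS pG; rewrite -defG mulG_subl.
have pL : p.-group L.
  by apply: pgroupS pG; rewrite -defG mulG_subr.
have [u [v [uz vL defx _]]] := mem_dprod dG xG.
have cuv : commute u v by apply: commute_sym; apply: (centsP cZL).
have /eqP : x ^+ p = 1 by rewrite -ox expg_order.
rewrite defx expgMn // -eq_invg_mul => /eqP upv.
have up1 : u ^+ p = 1.
  apply/eqP; rewrite -in_set1 -[[set 1]]tiZL inE groupX //.
  by rewrite -groupV upv groupX.
have vp1 : v ^+ p = 1 by rewrite -upv up1 invg1.
have [v1|ntv] := eqVneq v 1.
  by exists <[z]>%G, L; rewrite dG v1 mulg1 cycle_cyclic.
have ov := ntord v vp1 ntv.
have [C [K [dCK cycC vC]]] := IHb L v dL pL vL ov.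
have [u1|ntu] := eqVneq u 1.
  have := dG; rewrite -dCK dprodA (dprodC <[z]>) -dprodA.
  move=> dG'; have [[_ M _ defM] _ _ _] := dprodP dG'.
  by exists C, M; rewrite u1 mul1g -defM.
have ou := ntord u up1 ntu.
have [c defC] := cyclicP cycC.
have pc : p.-elt c.
  rewrite /p_elt orderE -defC; apply: pgroupS pL.
  by have [_ <- _ _] := dprodP dCK; apply: mulG_subl.
rewrite -dCK defC dprodA in dG.
have [[Q _ dQ _] _ _ _] := dprodP dG.
rewrite dQ in dG; rewrite defC in vC.
have conclude (y w : gT) : <[y]> \x <[w]> = Q -> u * v \in <[y]> ->
    exists C K : {group gT}, [/\ C \x K = G, cyclic C & u * v \in C].
  move=> dyw uvy; have := dG; rewrite -dyw -dprodA => dG'.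
  have [[_ M _ defM] _ _ _] := dprodP dG'.
  by exists <[y]>%G, M; rewrite -defM cycle_cyclic.
have [le_zc|/ltnW le_cz] := leqP #[z] #[c].
  by have [y] := cyclic_dprod_shear pr_p pz pc dQ uz vC ou ov le_zc; apply: conclude.
rewrite dprodC in dQ.
have [y] := cyclic_dprod_shear pr_p pc pz dQ vC uz ov ou le_cz.
by rewrite -cuv; apply: conclude.
Qed.

(** An abelian group is the direct product of its [p]-core and its [p']-core, and [x] lies in the
    former. *)
Lemma cyclic_dprod_factor (gT : finGroupType) (x : gT) (G : {group gT}) :
  abelian G -> x \in G -> prime #[x] ->
  exists C K : {group gT}, [/\ C \x K = G, cyclic C & x \in C].
Proof.
move=> abG xG; set p := #[x] => pr_p.
have nilG := abelian_nil abG.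
have := nilpotent_pcoreC p nilG; set P := 'O_p(G) => dG.
have xP : x \in P.
  have hallP := nilpotent_pcore_Hall p nilG.
  by rewrite (mem_normal_Hall hallP (pcore_normal _ _)) // /p_elt -/p pnat_id.
have abP : abelian P := abelianS (pcore_sub p G) abG.
have [C [K [dP cycC xC]]] :=
  cyclic_dprod_factor_pgroup abP (pcore_pgroup p G) xP pr_p (erefl p).
rewrite -[P]dP -dprodA in dG; have [[_ M _ defM] _ _ _] := dprodP dG.
by exists C, M; rewrite -defM.
Qed.

Lemma quotient_prime_cycle_isog_sub (gT : finGroupType) (x : gT) (G : {group gT}) :
  abelian G -> x \in G -> prime #[x] ->
  exists2 M : {group gT}, M \subset G & G / <[x]> \isog M.
Proof.
move=> abG xG pr_x.
have [C [K [dG cycC xC]]] := cyclic_dprod_factor abG xG pr_x.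
have [_ defG cCK tiCK] := dprodP dG.
have complK : K \in [complements to C in G] by apply/complP.
have sCG : C \subset G by rewrite -defG mulG_subl.
have sKG : K \subset G by rewrite -defG mulG_subr.
have nCG : C <| G by rewrite -sub_abelian_normal.
pose f y := divgr C K y ^+ #[x] * remgr C K y.
have divC y : y \in G -> divgr C K y \in C by rewrite -defG => /mem_divgr.
have remK y : y \in G -> remgr C K y \in K by rewrite -defG => /mem_remgr.
have fM : {in G &, {morph f : y z / y * z}}.
  move=> y z yG zG; rewrite /f (divgrM complK) // (remgrM complK) //.
  have cG (a b : gT) : a \in G -> b \in G -> commute a b.
    by move=> aG; apply: (centsP abG).
  have [dy dz] := (subsetP sCG _ (divC y yG), subsetP sCG _ (divC z zG)).
  have [ry rz] := (subsetP sKG _ (remK y yG), subsetP sKG _ (remK z zG)).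
  rewrite expgMn; last exact: cG.
  rewrite -!mulgA; congr (_ * _); rewrite !mulgA; congr (_ * _).
  by apply: cG; rewrite ?groupX.
exists (Morphism fM @* G)%G.
  apply/subsetP=> _ /morphimP[y _ yG ->] /=.
  have [dG' rG] := (subsetP sCG _ (divC y yG), subsetP sKG _ (remK y yG)).
  by rewrite /f groupM ?groupX.
suff <- : 'ker (Morphism fM) = <[x]> by apply: first_isog.
apply/eqP; rewrite eqEsubset cycle_subG; apply/andP; split; last first.
  by apply/kerP => //=; rewrite /f divgr_id // remgr1 // mulg1 expg_order.
(* If [f y = 1], the power of the [C]-component is inverse to the [K]-component, so both are
   trivial. Thus [y] lies in the cyclic group [C] and its order divides [#[x]], which places it in
   [<[x]>]. *)
apply/subsetP=> y /morphpreP[yG] /set1P /= fy1.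
have [dC rK] := (divC y yG, remK y yG).
have d1 : divgr C K y ^+ #[x] = 1.
  apply/eqP; rewrite -in_set1 -[[set 1]]tiCK inE groupX //.
  by move/eqP: fy1; rewrite -eq_invg_mul => /eqP rE; rewrite -groupV rE.
have yd : y = divgr C K y.
  by rewrite {1}(divgr_eq C K y); move: fy1; rewrite /f d1 mul1g => ->; rewrite mulg1.
rewrite -yd in dC d1.
have [->|nty] := eqVneq y 1; first exact: group1.
have oy : #[y] = #[x].
  by apply/(prime_nt_dvdP pr_x); rewrite ?order_eq1 // order_dvdn d1.
suff /eqP <- : <[y]> == <[x]> by apply: cycle_id.
by rewrite (eq_subG_cyclic cycC) ?cycle_subG // -!orderE oy.
Qed.

(** Induction on [#|H|]: factor out one subgroup [<[x]>] of prime order in [H]. By the third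
    isomorphism theorem [G / H] is a quotient of [G / <[x]>], so it embeds there, and [G / <[x]>]
    embeds in [G]. *)
Lemma quotient_isog_sub (gT : finGroupType) (G H : {group gT}) :
  abelian G -> H \subset G ->
  exists2 M : {group gT}, M \subset G & G / H \isog M.
Proof.
have [n] := ubnP #|H|; elim: n gT G H => // n IHn gT G H leHn abG sHG.
have [H1|] := eqVneq (H : {set gT}) 1.
  by exists G => //; rewrite H1 isog_sym quotient1_isog.
rewrite -cardG_gt1 => /pdiv_prime pr_p.
have [x xH ox] := Cauchy pr_p (pdiv_dvd #|H|).
rewrite -ox in pr_p.
have xG := subsetP sHG x xH.
have [M sMG isoM] := quotient_prime_cycle_isog_sub abG xG pr_p.
have sxH : <[x]> \subset H by rewrite cycle_subG.
have nxG : <[x]> <| G by rewrite -sub_abelian_normal ?cycle_subG.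
have nHG : H <| G by rewrite -sub_abelian_normal.
have [||| L sL isoL] := IHn _ (G / <[x]>)%G (H / <[x]>)%G.
- apply: leq_trans (ltnSE leHn); apply: ltn_quotient sxH.
  by rewrite cycle_eq1 -order_eq1 neq_ltn prime_gt1 ?orbT.
- exact: quotient_abelian.
- exact: quotientS.
have [f injf fG] := isogP isoM.
exists (f @* L)%G.
  by apply: subset_trans sMG; rewrite -fG morphimS.
have iso3 := third_isog sxH nxG nHG.
apply: isog_trans (isog_trans isoL (sub_isog sL injf)).
by rewrite isog_sym.
Qed.

(** * Tilings and coset representatives by counting *)

Lemma leq_card_mulg (gT : finGroupType) (A B : {set gT}) :
  #|A * B| <= #|A| * #|B|.
Proof.
rewrite -cardsX; apply: leq_trans (leq_imset_card (fun p => p.1 * p.2) _).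
apply/subset_leq_card/subsetP=> _ /imset2P[a b aA bB ->].
by apply/imsetP; exists (a, b); rewrite ?inE ?aA.
Qed.

(** Unique factorization means that multiplication maps [setX A T] bijectively onto [G]; for a
    surjection, injectivity is equality of cardinals. *)
Lemma tiling_pairP (gT : finGroupType) (G : {group gT}) (A T : {set gT}) :
  tiling_pair G A T <->
  [/\ A \subset G, T \subset G, A * T = G & (#|A| * #|T|)%N = #|G|].
Proof.
pose mul (p : gT * gT) := p.1 * p.2.
have defM : A * T = mul @: setX A T.
  apply/setP=> g; apply/imset2P/imsetP => [[a t aA tT ->]|[[a t] /setXP[aA tT] ->]].
    by exists (a, t); rewrite ?inE ?aA.
  by exists a t.
split=> [[sAG sTG uniqG]|[sAG sTG defG cardG]].
  have defG : A * T = G.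
    apply/eqP; rewrite eqEsubset mul_subG //; apply/subsetP=> g /uniqG[[a t]].
    by case=> [[/= aA tT ->]] _; apply: mem_mulg.
  split=> //; rewrite -defG defM card_in_imset ?cardsX // => -[a t] [b u].
  move=> /setXP[aA tT] /setXP[bA uT]; rewrite /mul /= => e.
  have /uniqG[p [_ up]] : a * t \in G by rewrite -defG mem_mulg.
  by rewrite -(up (a, t)) // -(up (b, u)).
split=> // g; rewrite -defG defM => /imsetP[[a t] /setXP[aA tT] ->].
exists (a, t); split=> // -[b u] [/= bA uT e].
have /imset_injP inj_mul : #|mul @: setX A T| == #|setX A T|.
  by rewrite -defM defG -cardG cardsX.
by apply: inj_mul; rewrite ?inE ?aA ?bA.
Qed.

Lemma tiling_pair_leq (gT : finGroupType) (G : {group gT}) (A T : {set gT}) :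
  A \subset G -> T \subset G -> G \subset A * T -> (#|A| * #|T| <= #|G|)%N ->
  tiling_pair G A T.
Proof.
move=> sAG sTG sGAT leATG; have defG : A * T = G.
  by apply/eqP; rewrite eqEsubset mul_subG.
apply/tiling_pairP; split=> //; apply/eqP; rewrite eqn_leq leATG /= -defG.
exact: leq_card_mulg.
Qed.

(** * Transfer of tilings and of the PT property along injective morphisms *)

Section TilingMorphism.

Variables (aT rT : finGroupType) (G : {group aT}) (f : {morphism G >-> rT}).
Hypothesis injf : 'injm f.

Lemma tiling_pair_morphim (A T : {set aT}) : A \subset G -> T \subset G ->
  tiling_pair G A T <-> tiling_pair (f @* G)%G (f @* A) (f @* T).
Proof.
move=> sAG sTG; split=> /tiling_pairP[_ _ defG cardG]; apply/tiling_pairP.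
  split; rewrite ?morphimS //; first by rewrite -morphimMl // defG.
  by rewrite !card_injm.
split=> //; last by rewrite -!(card_injm injf).
by apply: (injm_morphim_inj injf); rewrite ?mul_subG ?morphimMl.
Qed.

Lemma periodic_morphim (A : {set aT}) : A \subset G ->
  periodic G A <-> periodic (f @* G)%G (f @* A).
Proof.
move=> sAG; split=> -[ntA [g [gG g1 Ag]]]; split.
- by rewrite -card_gt0 card_injm // card_gt0.
- exists (f g); split; rewrite ?mem_morphim ?morph_injm_eq1 //.
  by rewrite -morphim_set1 // -morphimMl // -[in RHS]Ag.
- by rewrite -(card_gt0) -(card_injm injf) // card_gt0.
have [h hG _ def_g] := morphimP gG; rewrite {g gG}def_g in g1 Ag.
exists h; split=> //; first by rewrite -(morph_injm_eq1 injf).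
apply: (injm_morphim_inj injf); rewrite ?mul_subG ?sub1set //.
by rewrite morphimMl // morphim_set1.
Qed.

Lemma PT_property_injm : PT_property (f @* G)%G -> PT_property G.
Proof.
case=> [fG1|PTfG]; first by left; apply/eqP; rewrite -(morphim_injm_eq1 injf) ?fG1.
right=> A T tAT; have /tiling_pairP[sAG sTG _ _] := tAT.
have /PTfG[perA|[T' [perT' tAT']]] := (tiling_pair_morphim sAG sTG).1 tAT.
  by left; apply/periodic_morphim.
have /tiling_pairP[_ sT'G _ _] := tAT'.
have sTfG : f @*^-1 T' \subset G by apply: subsetIl.
right; exists (f @*^-1 T'); split.
  by apply/periodic_morphim; rewrite // morphpreK.
by apply/tiling_pair_morphim; rewrite // morphpreK.
Qed.

End TilingMorphism.

(** Turns the hypothesis on subgroups into one on quotients, which is the form the chain induction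
    uses. *)
Lemma PT_property_quotient (gT : finGroupType) (G H : {group gT}) :
  abelian G -> H \subset G ->
  (forall K : {group gT}, K \subset G -> PT_property K) ->
  PT_property (G / H)%G.
Proof.
move=> abG sHG PTG; have [M sMG /isogP[f injf fG]] := quotient_isog_sub abG sHG.
apply: (PT_property_injm injf).
have -> : (f @* (G / H) = M)%G by apply: val_inj.
exact: PTG.
Qed.

(** The covering makes [d |-> H :* d] map [D] onto the cosets, and the bound makes this map
    injective. *)
Lemma coset_repsP (gT : finGroupType) (H K : {group gT}) (D : {set gT}) :
  H \subset K ->
  coset_reps H K D <-> [/\ D \subset K, H * D = K & (#|H| * #|D| <= #|K|)%N].
Proof.
move=> sHK; split.
  move=> /[dup] /card_transversal cardD /and3P[_ sDK /forall_inP meetD].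
  split=> //; last by rewrite cardD Lagrange.
  apply/eqP; rewrite eqEsubset mul_subG //; apply/subsetP=> k kK.
  have /meetD/cards1P[d /setP/(_ d)] : H :* k \in rcosets H K.
    by apply/rcosetsP; exists k.
  rewrite !inE eqxx => /andP[dD /rcosetP[h hH ed]].
  by apply/mulsgP; exists h^-1 d; rewrite ?groupV // ed mulKg.
case=> sDK defK leDK; apply/and3P; split=> //; first exact: rcosets_partition.
have im_D : rcosets H K = (fun d => H :* d) @: D.
  apply/setP=> B; apply/rcosetsP/imsetP=> [[k kK ->]|[d dD ->]]; last first.
    by exists d; rewrite ?(subsetP sDK).
  move: kK; rewrite -defK => /mulsgP[h d hH dD ->]; exists d => //.
  by rewrite rcosetM rcoset_id.
have /imset_injP injD : #|(fun d => H :* d) @: D| == #|D|.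
  rewrite eqn_leq leq_imset_card -im_D -(leq_pmul2l (cardG_gt0 H)).
  by rewrite [leqRHS]Lagrange.
apply/forall_inP=> B; rewrite im_D => /imsetP[d dD ->].
apply/cards1P; exists d; apply/setP=> e; rewrite !inE.
apply/andP/eqP=> [[eD /rcoset_eqP ed]|->]; last by rewrite rcoset_refl.
exact: injD.
Qed.

Lemma coset_reps_exists (gT : finGroupType) (H K : {group gT}) :
  H \subset K -> exists2 D : {set gT}, 1 \in D & coset_reps H K D.
Proof.
(* [repr] returns 1 on any set containing 1, so the coset [H] itself is represented by 1. *)
move=> sHK; exists (repr @: rcosets H K).
  apply/imsetP; exists (H : {set gT}); first by apply/rcosetsP; exists 1; rewrite ?rcoset1.
  by rewrite /repr group1.
apply/coset_repsP => //; split.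
- apply/subsetP=> _ /imsetP[_ /rcosetsP[k kK ->] ->].
  by have /rcosetP[h hH ->] := mem_repr_rcoset H k; rewrite groupM ?(subsetP sHK h hH).
- apply/eqP; rewrite eqEsubset; apply/andP; split.
    apply: mul_subG => //; apply/subsetP=> _ /imsetP[_ /rcosetsP[k kK ->] ->].
    by have /rcosetP[h hH ->] := mem_repr_rcoset H k; rewrite groupM ?(subsetP sHK h hH).
  apply/subsetP=> k kK; have /rcosetP[h hH e] := mem_repr_rcoset H k.
  apply/mulsgP; exists h^-1 (repr (H :* k)); rewrite ?groupV //=.
    by apply: imset_f; apply/rcosetsP; exists k.
  by rewrite e mulKg.
by rewrite -(Lagrange sHK) leq_mul2l leq_imset_card orbT.
Qed.

Lemma coset_reps_mul (gT : finGroupType) (H K L : {group gT}) (D D' : {set gT}) :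
  H \subset K -> K \subset L -> coset_reps H K D -> coset_reps K L D' ->
  coset_reps H L (D * D').
Proof.
move=> sHK sKL /(coset_repsP _ sHK)[sDK defK leDK].
move=> /(coset_repsP _ sKL)[sD'L defL leD'L].
apply/coset_repsP; first exact: subset_trans sKL.
split; first by rewrite mul_subG // (subset_trans sDK).
  by rewrite mulgA defK.
apply: leq_trans leD'L; apply: leq_trans (_ : (#|H| * (#|D| * #|D'|) <= _)%N).
  by rewrite leq_mul2l leq_card_mulg orbT.
by rewrite mulnA leq_mul2r leDK orbT.
Qed.

(** * Alternating chains *)

(* [alt_chain G s H E] holds of [E = E j] and [H = H j], where [s] tells whether
   the sum is used at index [j].  The clause [D 0 = H 1] needs no separate case:
   representatives of [H 1] modulo [H 0 = 1] are all of [H 1]. *)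
Inductive alt_chain (gT : finGroupType) (G : {group gT}) :
    bool -> {group gT} -> {set gT} -> Prop :=
| AltTop s : alt_chain G s G [set 1]
| AltStep (s : bool) (H K : {group gT}) (D E E' : {set gT}) :
    H \proper K -> 1 \in D -> coset_reps H K D ->
    alt_chain G (~~ s) K E ->
    (if s then E' = D * E else is_circ D E E') -> alt_chain G s H E'.

Lemma coset_reps1 (gT : finGroupType) (K : {group gT}) (D : {set gT}) :
  coset_reps 1 K D <-> D = K.
Proof.
split=> [/(coset_repsP _ (sub1G K))[_ <- _]|->]; first by rewrite mul1g.
by apply/(coset_repsP _ (sub1G K)); split; rewrite ?mul1g // cards1 mul1n.
Qed.

Lemma alt_chain_acs (gT : finGroupType) (G : {group gT}) s (A : {set gT}) :
  alt_chain G s 1%G A -> ascending_chain_structure G A.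
Proof.
(* The flag is negated because index 0 is even: [odd 0 == ~~ s] holds exactly when [s] is true. *)
suff gen H : alt_chain G s H A ->
  exists m (Hs : nat -> {group gT}) (Ds Es : nat -> {set gT}),
  [/\ [/\ Hs 0 = H, Hs m = G & forall j : nat, j < m -> Hs j \proper Hs j.+1],
      forall j, j < m -> 1 \in Ds j /\ coset_reps (Hs j) (Hs j.+1) (Ds j),
      Es m = [set 1],
      forall j : nat, j < m ->
        if odd j == ~~ s then Es j = Ds j * Es j.+1
        else is_circ (Ds j) (Es j.+1) (Es j) &
      A = Es 0].
  case/gen=> m [Hs [Ds [Es [[H0 Hm pr] reps Em step ->]]]].
  case: m Hm pr reps Em step => [|m] Hm pr reps Em step.
    (* The clause [D 0 = H 1] is imposed even when [m = 0], where both values are otherwise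
       unconstrained. *)
    exists 0, Hs, (fun=> Hs 1%N), Es, (~~ s).
    split=> //; first by split=> //; [rewrite H0 | rewrite Hm].
    by split=> // j /andP[_].
  exists m.+1, Hs, Ds, Es, (~~ s); split=> //; first by rewrite H0 Hm.
  split=> [|j /andP[_ /reps//]].
  by apply/coset_reps1; have [_] := reps 0 isT; rewrite H0.
elim=> {H s A} [s|s H K D E E' prHK D1 repD _ IH defE'].
  by exists 0, (fun=> G), (fun=> set0), (fun=> [set 1]).
have [m [Hs [Ds [Es [[H0 Hm pr] reps Em step eqE]]]]] := IH.
exists m.+1, (fun j => if j is j'.+1 then Hs j' else H),
  (fun j => if j is j'.+1 then Ds j' else D),
  (fun j => if j is j'.+1 then Es j' else E').
split=> //.
- by split=> // -[|j]; [rewrite H0 | apply: pr].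
- by case=> [|j]; [rewrite H0 | apply: reps].
case=> [_ | j /step]; first by rewrite -eqE; case: (s) defE'.
by rewrite /=; case: (odd j); case: (s).
Qed.

Lemma acs_alt_chain (gT : finGroupType) (G : {group gT}) (A : {set gT}) :
  ascending_chain_structure G A -> exists s, alt_chain G s 1%G A.
Proof.
case=> m [Hs [Ds [Es [s [[H0 Hm pr] [D0 reps] Em step ->]]]]].
have Hs0 : Hs 0 = 1%G by apply: val_inj.
(* The inductive chain is built from the top, so [k] counts the levels below [H m = G]. *)
suff gen k : k <= m ->
    alt_chain G (odd (m - k) == s) (Hs (m - k)) (Es (m - k)).
  by exists (odd 0 == s); rewrite -Hs0 -(subnn m); apply: gen.
elim: k => [_|k IHk lt_km].
  by rewrite subn0 Em (val_inj Hm : Hs m = G); apply: AltTop.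
have := IHk (ltnW lt_km); rewrite -(subnSK lt_km).
have: m - k.+1 < m by rewrite ltn_subrL (leq_trans _ lt_km).
move: (m - k.+1)%N => j ltjm chj.
have [D1 repD] : 1 \in Ds j /\ coset_reps (Hs j) (Hs j.+1) (Ds j).
  case: j ltjm {chj} => [_|j ltjm]; last by apply: reps.
  by rewrite D0 group1 Hs0; split=> //; apply/coset_reps1.
apply: (AltStep (pr j ltjm) D1 repD _ (step j ltjm)).
by move: chj => /=; case: (odd j); case: (s).
Qed.

Lemma alt_chain_sub (gT : finGroupType) (G : {group gT}) s H E :
  alt_chain G s H E -> H \subset G.
Proof. by elim=> // {}s {}H K D {}E E' /proper_sub sHK *; apply: subset_trans sHK _. Qed.

(* Consecutive sums merge into one, as the sum of two sets of representatives
   represents the larger quotient; likewise for consecutive [circ]s. This is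
   what restores the alternation when a chain is extended downwards. *)
Lemma alt_chain_sum (gT : finGroupType) (G H K : {group gT}) s (D E : {set gT}) :
  H \proper K -> 1 \in D -> coset_reps H K D ->
  alt_chain G s K E -> alt_chain G true H (D * E).
Proof.
move=> + D1; case: s; last first.
  by move=> prHK repD chK; apply: (@AltStep _ _ true _ _ _ _ _ prHK D1 repD chK).
move=> prHK repD; move e: {1}true => s chK.
case: {s K E} chK e prHK repD => [s _|s K L D' E E1 prKL D'1 repD' chL + sT] prHK repD.
  (* At the top there is no operation to merge with, and [AltTop] accepts either flag. *)
  by apply: (@AltStep _ _ true _ _ _ _ _ prHK D1 repD (AltTop G _)).
rewrite -sT in chL *; move=> ->; rewrite mulgA.
have [sHK sKL] := (proper_sub prHK, proper_sub prKL).
apply: AltStep (proper_trans prHK prKL) _ (coset_reps_mul sHK sKL repD repD') chL _ => //.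
by rewrite -[1]mulg1 mem_mulg.
Qed.

Lemma alt_chain_circ (gT : finGroupType) (G H K : {group gT}) s (D E E' : {set gT}) :
  H \proper K -> 1 \in D -> coset_reps H K D ->
  alt_chain G s K E -> is_circ D E E' -> alt_chain G false H E'.
Proof.
move=> + D1; case: s; first by
  move=> prHK repD chK; apply: (@AltStep _ _ false _ _ _ _ _ prHK D1 repD chK).
move=> prHK repD; move e: {1}false => s chK.
case: {s K E} chK e prHK repD => [s _|s K L D' E E1 prKL D'1 repD' chL + sF] prHK repD.
  by apply: (@AltStep _ _ false _ _ _ _ _ prHK D1 repD (AltTop G _)).
rewrite -sF in chL *; move=> [psi [psiD psi1 ->]] [phi [phiD phi1 ->]].
have [sHK sKL] := (proper_sub prHK, proper_sub prKL).
apply: AltStep (proper_trans prHK prKL) _ (coset_reps_mul sHK sKL repD repD') chL _ => //.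
  by rewrite -[1]mulg1 mem_mulg.
(* The composite sends [b] first to [psi b * b] and then shifts this by [phi]; the total shift is
   the product of the two. *)
exists (fun b => phi (psi b * b) * psi b); split=> [b bE||].
- by rewrite mem_mulg ?psiD ?phiD //; apply: imset_f.
- by rewrite psi1 !mulg1.
by rewrite /circ -imset_comp; apply: eq_imset => b /=; rewrite mulgA.
Qed.

(** [H * B] is the preimage of [B / H], and each fibre is a coset of [H]. *)
Lemma card_mul_quotient (gT : finGroupType) (H : {group gT}) (B : {set gT}) :
  B \subset 'N(H) -> #|H * B| = (#|H| * #|B / H|)%N.
Proof.
move=> nHB; rewrite -quotientK // -sum1_card.
rewrite (partition_big (coset H) (mem (B / H))) /=; last first.
  by move=> x /morphpreP[].
rewrite mulnC -sum_nat_const; apply: eq_bigr => _ /morphimP[b nHb bB ->].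
rewrite -(card_rcoset H b) -sum1_card; apply: eq_bigl => x.
rewrite -val_coset // ; apply/andP/idP => [[/morphpreP[nHx _] /eqP <-]|xHb].
  by rewrite val_coset // rcoset_refl.
have /rcosetP[h hH ->] : x \in H :* b by rewrite -val_coset.
rewrite coset_kerl // eqxx; split=> //; apply/morphpreP; split.
  by rewrite groupM // (subsetP (normG H)).
by rewrite /= coset_kerl //; apply: mem_morphim.
Qed.

(** Reduction modulo [K] factors through reduction modulo [H]. *)
Lemma leq_card_quotient (gT : finGroupType) (H K : {group gT}) (B : {set gT}) :
  H \subset K -> B \subset 'N(H) -> B \subset 'N(K) -> #|B / K| <= #|B / H|.
Proof.
move=> sHK nHB nKB.
apply: leq_trans (leq_imset_card (fun c : coset_of H => coset K (repr c)) (mem (B / H))).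
apply/subset_leq_card/subsetP=> _ /morphimP[b nKb bB ->].
have nHb := subsetP nHB b bB.
apply/imsetP; exists (coset H b); first exact: mem_morphim.
have: repr (coset H b) \in H :* b by rewrite val_coset ?mem_repr_rcoset.
by case/rcosetP=> h hH ->; rewrite coset_kerl ?(subsetP sHK).
Qed.

(** * From tilings to chains *)

Lemma is_circ_mul_sub (gT : finGroupType) (D E E' : {set gT}) :
  is_circ D E E' -> E' \subset D * E.
Proof.
case=> phi [phiD _ ->]; apply/subsetP=> _ /imsetP[e eE ->].
by rewrite mem_mulg ?phiD.
Qed.

(** The shifts lie in [D], hence in [K], so they are invisible modulo [K]. *)
Lemma mulg_is_circ (gT : finGroupType) (K : {group gT}) (D E E' : {set gT}) :
  D \subset K -> is_circ D E E' -> K * E' = K * E.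
Proof.
move=> sDK circE; apply/eqP; rewrite eqEsubset; apply/andP; split.
  rewrite -{2}(mulGid K) -mulgA mulgSS //.
  by rewrite (subset_trans (is_circ_mul_sub circE)) // mulSg.
have [phi [phiD _ ->]] := circE.
apply/subsetP=> _ /mulsgP[k e kK eE ->].
apply/mulsgP; exists (k * (phi e)^-1) (phi e * e).
- by rewrite groupM // groupV (subsetP sDK) ?phiD.
- exact: imset_f.
by rewrite mulgA mulgKV.
Qed.

Lemma abelian_mulC (gT : finGroupType) (G : {group gT}) (A B : {set gT}) :
  abelian G -> A \subset G -> B \subset G -> A * B = B * A.
Proof. by move=> abG sAG sBG; apply/centC/(centSS sAG sBG). Qed.

Lemma tiling_pairC (gT : finGroupType) (G : {group gT}) (A T : {set gT}) :
  abelian G -> tiling_pair G A T -> tiling_pair G T A.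
Proof.
move=> abG /tiling_pairP[sAG sTG defG cardG]; apply/tiling_pairP.
split=> //; last by rewrite mulnC.
by rewrite (abelian_mulC abG).
Qed.

Section AbelianTilings.

Variables (gT : finGroupType) (G : {group gT}).
Hypothesis abG : abelian G.

Let abelian_norm (A : {set gT}) (H : {group gT}) : A \subset G -> H \subset G ->
  A \subset 'N(H).
Proof. by move=> sAG sHG; apply/cents_norm/(centSS sAG sHG). Qed.

Let card_quotientG (H : {group gT}) : H \subset G ->
  (#|H| * #|(G / H)%G| = #|G|)%N.
Proof. by move=> sHG; rewrite -card_mul_quotient ?mulSGid ?abelian_norm. Qed.

(** The covering survives reduction modulo [K]. For the count, invariance of [B] modulo [H] under
    [K] gives [#|K| * #|B / K| = #|H| * #|B / H|], while the image of [T] can only shrink. *)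
Lemma tiling_pair_coarsen (H K : {group gT}) (B T : {set gT}) :
  H \subset K -> K \subset G -> B \subset G -> T \subset G -> K * B = H * B ->
  tiling_pair (G / H)%G (B / H) (T / H) -> tiling_pair (G / K)%G (B / K) (T / K).
Proof.
move=> sHK sKG sBG sTG eqKB /tiling_pairP[_ _ defGH cardGH].
have sHG := subset_trans sHK sKG.
have [nHB nKB] := (abelian_norm sBG sHG, abelian_norm sBG sKG).
have [nHT nKT] := (abelian_norm sTG sHG, abelian_norm sTG sKG).
apply: tiling_pair_leq; rewrite ?quotientS //.
  have defG : H * (B * T) = G.
    rewrite -quotientK ?abelian_norm ?mul_subG // quotientMl // defGH quotientGK //.
    by rewrite -sub_abelian_normal.
  rewrite /= -{1}defG mulgA -eqKB -mulgA -quotientMl //.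
  by rewrite quotientMidl.
have cardB : (#|K| * #|B / K| = #|H| * #|B / H|)%N.
  by rewrite -!card_mul_quotient // eqKB.
rewrite -(leq_pmul2l (cardG_gt0 K)) mulnA cardB -mulnA (card_quotientG sKG).
by rewrite -(card_quotientG sHG) -cardGH !leq_mul2l leq_card_quotient ?orbT.
Qed.

Lemma periodic_quotient (H : {group gT}) (B : {set gT}) :
  H \subset G -> B \subset G -> periodic (G / H)%G (B / H) ->
  exists K : {group gT}, [/\ H \proper K, K \subset G & K * B = H * B].
Proof.
move=> sHG sBG [_ [_ [/morphimP[g nHg gG ->] g1 Bg]]].
have sHBG : H * B \subset G by rewrite mul_subG.
(* [K] is the stabilizer of [H * B] under translation; it contains [H] and the lift [g] of the
   period, which is outside [H]. *)
pose K := [group of 'N_G(H * B | 'R)].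
have KP k : reflect (k \in G /\ forall x, (x * k \in H * B) = (x \in H * B)) (k \in K).
  apply: (iffP setIP) => -[kG kHB]; split=> //; first exact: (astabsP kHB).
  exact/astabsP.
have subK : K \subset G by apply: subsetIl.
have sHK : H \subset K.
  apply/subsetP=> h hH; apply/KP; split=> [|x]; first exact: (subsetP sHG).
  have hHBh : (H * B) :* h = H * B.
    by rewrite (abelian_mulC abG sHG sBG) -mulgA rcoset_id.
  by rewrite -{1}hHBh mem_rcoset mulgK.
exists K; split=> //.
  rewrite properE sHK; apply: contra g1 => /subsetP sKH.
  apply/eqP/coset_id/sKH/KP; split=> // x.
  have {1}<- : (H * B) :* g = H * B.
    rewrite -mulgA -!quotientK ?abelian_norm ?mul_subG ?sub1set //.
    rewrite quotientMl ?abelian_norm //.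
    by rewrite quotient_set1 ?Bg.
  by rewrite mem_rcoset mulgK.
apply/eqP; rewrite eqEsubset (mulSg B sHK) andbT.
apply/subsetP=> _ /mulsgP[k b kK bB ->].
have /KP[kG] := kK; rewrite (centsP abG k kG b (subsetP sBG b bB)) => ->.
by rewrite (subsetP (mulG_subr _ _)).
Qed.

Lemma alt_chain_tile (H : {group gT}) (B T : {set gT}) :
  (forall K : {group gT}, K \subset G -> PT_property (G / K)%G) ->
  H \subset G -> B \subset G -> T \subset G -> 1 \in B ->
  tiling_pair (G / H)%G (B / H) (T / H) ->
  exists s E, alt_chain G s H E /\ H * E = H * B.
Proof.
move=> PTq; have [n] := ubnP (#|G| - #|H|).
elim: n H B T => // n IHn H B T leHn sHG sBG sTG B1 tBT.
have [eqHG|neqHG] := eqVneq H G.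
  exists true, [set 1]; rewrite eqHG; split; first exact: AltTop.
  apply/eqP; rewrite mulg1 eqEsubset mul_subG // andbT.
  by rewrite -{1}[G : {set gT}]mulg1 mulgS ?sub1set.
have ltKn (K : {group gT}) : H \proper K -> K \subset G -> #|G| - #|K| < n.
  move=> prHK sKG; apply: leq_trans (ltnSE leHn).
  by rewrite ltn_sub2l ?(proper_card prHK) // proper_card // (proper_sub_trans prHK).
(* The conventional case of a trivial quotient is excluded by [H != G]. *)
have [/trivgP|PTGH] := PTq H sHG.
  rewrite quotient_sub1 ?abelian_norm // => sGH; case/eqP: neqHG.
  by apply/val_inj/eqP; rewrite eqEsubset sHG.
have [perB|[T' [perT' tBT']]] := PTGH _ _ tBT.
  have [K [prHK sKG eqKB]] := periodic_quotient sHG sBG perB.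
  have sHK := proper_sub prHK.
  have tK := tiling_pair_coarsen sHK sKG sBG sTG eqKB tBT.
  have [s [E [chE eqE]]] := IHn K B T (ltKn K prHK sKG) sKG sBG sTG B1 tK.
  have [D D1 repD] := coset_reps_exists sHK.
  exists true, (D * E); split; first exact: alt_chain_sum chE.
  have [_ defK _] := (coset_repsP _ sHK).1 repD.
  by rewrite mulgA defK eqE.
have [_ sT'GH _ _] := (tiling_pairP _ _ _).1 tBT'.
pose T1 := coset H @*^-1 T'.
have defT' : T1 / H = T' by apply: cosetpreK.
have sT1G : T1 \subset G.
  by rewrite -(quotientGK (_ : H <| G)) ?morphpreS // -sub_abelian_normal.
rewrite -defT' in perT' tBT'.
have [K [prHK sKG eqKT]] := periodic_quotient sHG sT1G perT'.
have sHK := proper_sub prHK.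
have abGH : abelian (G / H) by apply: quotient_abelian.
have tK : tiling_pair (G / K)%G (B / K) (T1 / K).
  apply: tiling_pairC; first exact: quotient_abelian.
  exact/(tiling_pair_coarsen sHK sKG sT1G sBG eqKT)/tiling_pairC.
have [s [E [chE eqE]]] := IHn K B T1 (ltKn K prHK sKG) sKG sBG sT1G B1 tK.
have [D D1 repD] := coset_reps_exists sHK.
have [sDK defK _] := (coset_repsP _ sHK).1 repD.
have sEG : E \subset G.
  by rewrite (subset_trans (mulG_subr K _)) // eqE mul_subG.
(* Each [e] is moved within its [K]-coset to a point of [H * B]. The value at 1 can be forced since
   [1 \in B]; [phiP] shows that the default of [odflt] never arises on [E]. *)
pose phi e := if e == 1 then 1 else odflt 1 [pick d in D | d * e \in H * B].
have phiP e : e \in E -> phi e \in D /\ phi e * e \in H * B.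
  rewrite /phi; case: eqP => [->|_] eE.
    by rewrite mulg1 D1 -[1]mulg1 mem_mulg.
  case: pickP => [d /andP[]//|/= noD].
  have: e \in K * B by rewrite -eqE (subsetP (mulG_subr _ _)).
  case/mulsgP=> k b kK bB def_e.
  have: k^-1 \in H * D by rewrite defK groupV.
  (* With [e = k * b] and [k^-1 = h * d], the product [d * e] equals [h^-1 * b]. *)
  case/mulsgP=> h d hH dD def_k; have /andP[] := negbT (noD d); split=> //.
  apply/mulsgP; exists h^-1 b; rewrite ?groupV //.
  by rewrite def_e -[k]invgK def_k invMg !mulgA mulgV mul1g.
have circE : is_circ D E (circ phi E).
  by exists phi; split=> // [e /phiP[]//|]; rewrite /phi eqxx.
exists false, (circ phi E); split; first exact: alt_chain_circ chE circE.
have eqKE : K * circ phi E = K * B by rewrite (mulg_is_circ sDK circE).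
have sCG : circ phi E \subset G.
  by rewrite (subset_trans (mulG_subr K _)) // eqKE mul_subG.
(* One inclusion holds by the choice of [phi]; equality comes from counting. Both tilings with [T1]
   and [#|H| * #|T1 / H| = #|K| * #|T1 / K|] give [#|B / H| = #|B / K|], which is the size of
   [circ phi E / K] and so at most that of [circ phi E / H]. *)
apply/eqP; rewrite eqEcard; apply/andP; split.
  have sC : circ phi E \subset H * B.
    by apply/subsetP=> _ /imsetP[e /phiP[_ eB] ->].
  by rewrite -{2}(mulGid H) -mulgA mulgS.
rewrite !card_mul_quotient ?abelian_norm // leq_pmul2l //.
apply: leq_trans (leq_card_quotient sHK _ _); rewrite ?abelian_norm //.
have -> : #|circ phi E / K| = #|B / K|.
  apply/eqP; rewrite -(eqn_pmul2l (cardG_gt0 K)).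
  by rewrite -!card_mul_quotient ?abelian_norm ?eqKE.
have [_ _ _ cardH] := (tiling_pairP _ _ _).1 tBT'.
have [_ _ _ cardK] := (tiling_pairP _ _ _).1 tK.
have cardT : (#|H| * #|T1 / H| = #|K| * #|T1 / K|)%N.
  by rewrite -!card_mul_quotient ?abelian_norm ?eqKT.
have card_gt0T : 0 < #|K| * #|T1 / K|.
  rewrite muln_gt0 cardG_gt0 lt0n; apply/eqP => T0.
  by have := cardG_gt0 (G / K)%G; rewrite -cardK T0 muln0.
rewrite -(leq_pmul2r card_gt0T) -{1}cardT !(mulnCA #|B / _|) cardH cardK.
by rewrite !card_quotientG.
Qed.

End AbelianTilings.

(** * From chains to tilings *)

(** Since [H * D = K], moving [D] into the complement restores [K], modulo which [E'] and [E] agree.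
    For the count, [E'] is an image of [E] and [#|H| * #|D| <= #|K|]. *)
Lemma circ_complement (gT : finGroupType) (G H K : {group gT})
    (D E E' S : {set gT}) :
  abelian G -> H \subset K -> K \subset G -> E \subset G -> S \subset G ->
  coset_reps H K D -> is_circ D E E' ->
  G \subset E * S * K -> #|E| * #|S| * #|K| <= #|G| ->
  G \subset E' * (D * S) * H /\ #|E'| * #|D * S| * #|H| <= #|G|.
Proof.
move=> abG sHK sKG sEG sSG /(coset_repsP _ sHK)[sDK defK leK] circE covG leG.
have comm A B := @abelian_mulC _ _ A B abG.
have [sHG sDG] := (subset_trans sHK sKG, subset_trans sDK sKG).
have sE'G : E' \subset G.
  by rewrite (subset_trans (is_circ_mul_sub circE)) // mul_subG.
split.
  rewrite (comm _ H) ?mul_subG // (comm E') ?mul_subG // !mulgA defK -mulgA.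
  rewrite (comm S) // mulgA (mulg_is_circ sDK circE) -mulgA.
  by rewrite comm ?mul_subG.
apply: leq_trans leG; have [phi [_ _ ->]] := circE.
rewrite -mulnA; apply: leq_trans (_ : (#|E| * (#|D| * #|S| * #|H|) <= _)%N).
  by rewrite !leq_mul ?leq_imset_card ?leq_card_mulg.
by rewrite -[leqRHS]mulnA leq_mul2l (mulnC #|D|) -mulnA leq_mul2l mulnC leK !orbT.
Qed.

(** Here [K] is split as [H * D] and the factor [D] goes to the chain set instead of the
    complement. *)
Lemma sum_complement (gT : finGroupType) (G H K : {group gT}) (D E S : {set gT}) :
  abelian G -> H \subset K -> K \subset G -> E \subset G -> S \subset G ->
  coset_reps H K D -> G \subset E * S * K -> #|E| * #|S| * #|K| <= #|G| ->
  G \subset D * E * S * H /\ #|D * E| * #|S| * #|H| <= #|G|.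
Proof.
move=> abG sHK sKG sEG sSG /(coset_repsP _ sHK)[sDK defK leK] covG leG.
have comm A B := @abelian_mulC _ _ A B abG.
have [sHG sDG] := (subset_trans sHK sKG, subset_trans sDK sKG).
split.
  by rewrite comm ?mul_subG // !mulgA defK -mulgA comm ?mul_subG.
apply: leq_trans leG.
apply: leq_trans (_ : (#|D| * #|E| * #|S| * #|H| <= _)%N).
  by rewrite !leq_mul ?leq_card_mulg.
by rewrite -(mulnA #|D|) (mulnC #|D|) -mulnA (mulnC #|D|) leq_mul2l leK orbT.
Qed.

(** Covering together with the cardinality bound says that every element of [G] factors uniquely
    through [E], [S] and [H]; this form passes down the chain without forming quotients. *)
Lemma alt_chain_complement (gT : finGroupType) (G H : {group gT}) s E :
  abelian G -> alt_chain G s H E ->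
  E \subset G /\ exists S : {set gT},
    [/\ S \subset G, G \subset E * S * H & #|E| * #|S| * #|H| <= #|G|].
Proof.
move=> abG; elim=> {s H E} [s|s H K D E E' /proper_sub sHK D1 repD chE IH stepE].
  split; first by rewrite sub1set.
  by exists [set 1]; rewrite sub1set !mul1g cards1 !mul1n; split.
have [sEG [S [sSG covG leG]]] := IH.
have sKG := alt_chain_sub chE.
have [sDK _ _] := (coset_repsP _ sHK).1 repD.
have sDG := subset_trans sDK sKG.
case: s {chE IH} stepE => [->|circE].
  split; first by rewrite mul_subG.
  by exists S; have [] := sum_complement abG sHK sKG sEG sSG repD covG leG.
split; first by rewrite (subset_trans (is_circ_mul_sub circE)) // mul_subG.
exists (D * S); rewrite mul_subG //.
by have [] := circ_complement abG sHK sKG sEG sSG repD circE covG leG.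
Qed.

Lemma tiling_pair_lcoset (gT : finGroupType) (G : {group gT}) (A T : {set gT}) g :
  g \in G -> tiling_pair G A T -> tiling_pair G (g *: A) T.
Proof.
move=> gG /tiling_pairP[sAG sTG defG cardG]; apply/tiling_pairP.
by rewrite mul_subG ?sub1set // -mulgA defG lcoset_id // card_lcoset.
Qed.

Lemma periodic_mulG (gT : finGroupType) (G K : {group gT}) (A : {set gT}) :
  abelian G -> K \subset G -> K :!=: 1 -> A \subset G -> A != set0 ->
  periodic G (K * A).
Proof.
move=> abG sKG /trivgPn[k kK k1] sAG /set0Pn[a aA]; split.
  by apply/set0Pn; exists (k * a); rewrite mem_mulg.
exists k; rewrite (subsetP sKG) //; split=> //.
by rewrite (centC (centSS sKG sAG abG)) -mulgA rcoset_id.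
Qed.

Lemma alt_chain_periodic (gT : finGroupType) (G : {group gT}) s (E : {set gT}) :
  abelian G -> G :!=: 1 -> 1 \in E -> alt_chain G s 1%G E ->
  periodic G E \/ exists S, periodic G S /\ tiling_pair G E S.
Proof.
move=> abG ntG E1 chE; have [sEG _] := alt_chain_complement abG chE.
move: chE; move defH: 1%G => H chE.
case: {s H E} chE defH E1 sEG => [s G1|s H K D E0 E prHK D1 repD chE0 stepE H1 E1 sEG].
  by rewrite -G1 eqxx in ntG.
move: prHK repD; rewrite -H1 => prK /coset_reps1 defD.
have ntK : K :!=: 1 by rewrite -proper1G.
have [sE0G [S [sSG covG leG]]] := alt_chain_complement abG chE0.
have sKG := alt_chain_sub chE0.
have nonempty (A : {set gT}) : G \subset A -> A != set0.
  by move=> sGA; apply/set0Pn; exists 1; rewrite (subsetP sGA).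
have [ntE0 ntS] : E0 != set0 /\ S != set0.
  by split; apply: contraNneq (nonempty _ covG) => ->; rewrite ?mulg0 !mul0g.
(* The bottom operation decides which side is periodic: a sum makes [E] a union of [K]-cosets, a
   [circ] does so for the complement [D * S]. *)
case: s chE0 stepE => [_ ->|_ circE].
  by left; rewrite defD; apply: periodic_mulG.
right; exists (D * S); rewrite {1}defD; split; first exact: periodic_mulG.
have repD : coset_reps 1 K D by apply/coset_reps1.
have [cov le] := circ_complement abG (sub1G K) sKG sE0G sSG repD circE covG leG.
apply: tiling_pair_leq => //; first by rewrite mul_subG // defD.
  by move: cov; rewrite /= mulg1.
by move: le; rewrite cards1 muln1.
Qed.

Lemma periodic_lcoset (gT : finGroupType) (G : {group gT}) (A : {set gT}) g :
  periodic G A -> periodic G (g *: A).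
Proof.
case=> ntA [k [kG k1 Ak]]; split; first by rewrite -card_gt0 card_lcoset card_gt0.
by exists k; rewrite -mulgA Ak.
Qed.

Theorem theorem1p7 (gT : finGroupType) (G : {group gT}) (abG : abelian G) :
  (PT_property G ->
   (forall H : {group gT}, H \subset G -> PT_property H) ->
   forall A : {set gT}, tile G A -> 1 \in A -> ascending_chain_structure G A)
  /\
  ((forall A : {set gT}, tile G A -> 1 \in A -> ascending_chain_structure G A) ->
   PT_property G).
Proof.
split=> [_ PTG A [T tAT] A1 | acsG].
  have /tiling_pairP[sAG sTG _ _] := tAT.
  have PTq (K : {group gT}) : K \subset G -> PT_property (G / K)%G.
    by move=> sKG; apply: PT_property_quotient.
  (* The chain induction starts at the trivial subgroup, where agreement modulo [H] is equality. *)
  have tAT1 : tiling_pair (G / 1)%G (A / 1) (T / 1).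
    have [_ _ defG cardG] := (tiling_pairP _ _ _).1 tAT.
    apply: tiling_pair_leq; rewrite ?quotientS //.
      by rewrite -quotientMl ?norms1 ?defG.
    by rewrite -(card_isog (quotient1_isog G)) -cardG leq_mul ?leq_morphim.
  have [s [E [chE]]] := alt_chain_tile abG PTq (sub1G G) sAG sTG A1 tAT1.
  by rewrite !mul1g => eqEA; rewrite eqEA in chE; apply: alt_chain_acs chE.
have [G1|ntG] := eqVneq (G : {set gT}) 1; [by left | right=> A T tAT].
have /tiling_pairP[sAG sTG defG _] := tAT.
have /mulsgP[a t aA tT _] : 1 \in A * T by rewrite defG.
(* The chain hypothesis concerns tiles containing 1, so [A] is translated by [a^-1]; translating
   back preserves periodicity and keeps the same complements. *)
have aG := subsetP sAG a aA.
have aVG : a^-1 \in G by rewrite groupV.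
have tB := tiling_pair_lcoset aVG tAT.
have B1 : 1 \in a^-1 *: A by rewrite mem_lcoset invgK mulg1.
have /acs_alt_chain[s chB] := acsG _ (ex_intro _ T tB) B1.
have aK (X : {set gT}) : a *: (a^-1 *: X) = X.
  by rewrite mulgA mulg_set1 mulgV mul1g.
case: (alt_chain_periodic abG ntG B1 chB) => [perB|[S [perS tBS]]].
  by left; rewrite -[A]aK; apply: periodic_lcoset.
by right; exists S; split=> //; rewrite -[A]aK; apply: tiling_pair_lcoset.
Qed.
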